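(* Let $p$ be an odd prime and $d$ a positive integer with $p^d \geqslant 7$, and let $n = p^d$. Let $G$ be $S_n$ or $A_n$ and $H = \mathrm{AGL}_d(p) \cap G$. If $d = 1$, then $\mathrm{I}(G,H) = 1 + \Omega(p-1) + \varepsilon(G)$. If $d \geqslant 2$ and $p \in \{3,5\}$, then \[ \frac{d(d+1)}{2} + d - 1 + \varepsilon(G) \leqslant \mathrm{I}(G,H) < \frac{d(d+1)}{2}(1+\log p) + \varepsilon(G). \] If $d \geqslant 2$ and $p \geqslant 7$, then \[ \frac{d(d+1)}{2} + d\,\Omega(p-1) - 1 + \varepsilon(G) \leqslant \mathrm{I}(G,H) < \frac{d(d+1)}{2}(1+\log p) + \varepsilon(G). \]
   Context: $\mathrm{AGL}_d(p)$ is viewed as a subgroup of $S_{p^d}$ via its action on $\mathbb{F}_p^d$. $\mathrm{I}(G,H)$ denotes the maximum size of an irredundant base for the action of $G$ on the right cosets of $H$; an irredundant base is a sequence $(\gamma_1,\ldots,\gamma_l)$ of points with $G > G_{\gamma_1} > G_{\gamma_1,\gamma_2} > \cdots > G_{\gamma_1,\ldots,\gamma_l} = 1$. $\Omega(k)$ is the number of prime factors of $k$ counted with multiplicity. $\varepsilon(G)$ is the length (maximum length of a strictly descending chain of subgroups) of $G/\mathrm{soc}(G)$; thus $\varepsilon(S_n) = 1$ and $\varepsilon(A_n) = 0$ here. Logarithms are to base $2$. *)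

(* Defs.v *)
From mathcomp Require Import all_boot all_order all_algebra all_fingroup all_solvable.
From Stdlib Require Reals.
Set Implicit Arguments. Unset Strict Implicit. Unset Printing Implicit Defensive.
Import GroupScope.

Definition bigOmega (k : nat) : nat := \sum_(q <- primes k) logn q k.

Section Base.
Variable gT : finGroupType.

(* Pointwise stabiliser in G of the right cosets H g_1, ..., H g_k
   (the stabiliser of the coset H g in G is H :^ g = g^-1 H g). *)
Definition coset_stab (G H : {set gT}) (t : seq gT) : {set gT} :=
  G :&: \bigcap_(g <- t) (H :^ g).

(* t = (g_1,...,g_l) encodes the sequence of points (H g_1, ..., H g_l) of the
   action of G on the right cosets of H; it is an irredundant base iff
   G > G_{Hg1} > G_{Hg1,Hg2} > ... > G_{Hg1,...,Hgl} = 1. *)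
Definition irred_base (G H : {set gT}) (t : seq gT) : bool :=
  all (mem G) t &&
  [&& [forall i : 'I_(size t),
          coset_stab G H (take i.+1 t) \proper coset_stab G H (take i t)]
    & coset_stab G H t == 1].

(* I(G,H): maximum size of an irredundant base (any irredundant base has
   length at most log2 |G| <= |G|, so the bound #|G| is harmless). *)
Definition Ibase (G H : {set gT}) : nat :=
  \max_(l < #|G|.+1 | [exists t : l.-tuple gT, irred_base G H t]) l.
End Base.

Definition AGL (d p : nat) : {set {perm 'rV['F_p]_d}} :=
  [set s : {perm 'rV['F_p]_d} | [exists A : 'M['F_p]_d, exists b : 'rV['F_p]_d,
      (A \in unitmx) && [forall x, s x == (x *m A + b)%R]]].

(* epsilon(G) = length of G/soc(G); for G in {S_n, A_n} (n >= 7) this is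
   1 for S_n and 0 for A_n. *)
Definition eps_SA (T : finType) (G : {set {perm T}}) : nat := (G == 'Sym_T).

Definition log2R (x : Reals.Rdefinitions.R) : Reals.Rdefinitions.R :=
  Reals.Rdefinitions.Rdiv (Reals.Rpower.ln x) (Reals.Rpower.ln (Reals.Raxioms.INR 2)).

(* Main.v *)
Require Import Defs.
From mathcomp Require Import all_boot all_order all_algebra all_fingroup all_solvable.
From mathcomp Require Import finfield zify.

(* An irredundant base is a strictly descending chain of intersections of
   conjugates of H = AGL_d(p) :&: G.

   Upper bounds: below H each step loses a prime factor of the order, and
   |AGL_d(p)| = p^t \prod_(i <= d) (p^i - 1), where the product is < p^t. For
   d = 1, two distinct conjugates of H meet in a p'-group, since AGL_1(p) is
   the normaliser of the translations, so the second step loses the factor p.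

   Lower bounds: AGL_d(p) contains odd permutations, so intersecting a chain for
   S_n with A_n costs at most one step, and it suffices to treat S_n. If g moves
   few points then AGL :&: AGL^g is the centraliser of g in AGL. Taking g = -1
   on a coordinate subspace and 1 off it yields the stabilisers of coordinate
   subspaces; these lead from AGL through the parabolic subgroups to the
   triangular matrices in d - 1 steps, and then, one matrix entry at a time, to
   the diagonal torus T. Finally T is cut down one coordinate and one prime
   factor of p - 1 at a time. For d = 1 the torus is instead the intersection of
   AGL_1(p) with its conjugate by z |-> 1/z. *)

Set Implicit Arguments. Unset Strict Implicit. Unset Printing Implicit Defensive.
Import GRing.Theory.

(** * Stabiliser chains and irredundant bases *)

Section StabChains.

Local Open Scope group_scope.

Variable gT : finGroupType.

(* [stab_chain G H l K]: [K] is the pointwise stabiliser of [l] right cosets of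
   [H], each of which is moved by the stabiliser of the previous ones. *)
Inductive stab_chain (G H : {set gT}) : nat -> {set gT} -> Prop :=
| stab_chain0 : stab_chain G H 0 G
| stab_chainS l K g : stab_chain G H l K -> g \in G ->
    K :&: H :^ g \proper K -> stab_chain G H l.+1 (K :&: H :^ g).

Lemma coset_stab_rcons (G H : {set gT}) t g :
  coset_stab G H (rcons t g) = coset_stab G H t :&: H :^ g.
Proof. by rewrite /coset_stab big_rcons setIA. Qed.

Lemma stab_chainP (G H : {set gT}) l K :
  stab_chain G H l K <->
  exists t, [/\ size t = l, all (mem G) t,
    forall i, i < size t ->
      coset_stab G H (take i.+1 t) \proper coset_stab G H (take i t)
    & coset_stab G H t = K].
Proof.
split=> [|[t [<- {l} + + <- {K}]]].
  elim=> [|{}l {}K g _ [t [<- tG tP <-]] gG KP].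
    by exists [::]; split; rewrite // /coset_stab big_nil setIT.
  exists (rcons t g); split; rewrite ?size_rcons ?all_rcons ?tG ?andbT //.
  - move=> i; rewrite ltnS leq_eqVlt => /predU1P[->|lt_i].
      by rewrite -{1}(size_rcons t g) take_size -cats1 take_size_cat // cats1
                 coset_stab_rcons.
    by rewrite -cats1 !takel_cat ?tP // ltnW.
  - exact: coset_stab_rcons.
elim/last_ind: t => [|t g IHt] tG tP.
  by rewrite /coset_stab big_nil setIT; apply: stab_chain0.
rewrite coset_stab_rcons size_rcons.
move: tG; rewrite all_rcons => /andP[gG tG].
apply: stab_chainS => //.
  apply: IHt => // i lt_i; have := tP i; rewrite size_rcons ltnS ltnW // => /(_ isT).
  by rewrite -cats1 !takel_cat // ltnW.
have := tP (size t); rewrite size_rcons ltnSn => /(_ isT).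
by rewrite -{1}(size_rcons t g) take_size -cats1 take_size_cat // cats1 coset_stab_rcons.
Qed.

(** Each step loses at least one element, so every chain length lies in the range over which [Ibase]
    maximises. *)
Lemma stab_chain_card (G H : {set gT}) l K :
  stab_chain G H l K -> l + #|K| <= #|G|.
Proof.
elim=> [|{}l {}K g _ IH _ /proper_card]; first by rewrite add0n.
by move=> lt_K; apply: leq_trans IH; rewrite addSnnS leq_add2l.
Qed.

Lemma irred_baseP (G H : {set gT}) l :
  reflect (stab_chain G H l 1) [exists t : l.-tuple gT, irred_base G H t].
Proof.
apply: (iffP existsP) => [[t /and3P[tG /forallP tP /eqP t1]]|].
  apply/stab_chainP; exists t; split; rewrite ?size_tuple // => i lt_i.
  by have := tP (Ordinal (eq_ind_r (fun n => i < n) lt_i (size_tuple t))).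
case/stab_chainP=> t [sz_t tG tP t1]; exists (Tuple (introT eqP sz_t)).
by apply/and3P; split; rewrite ?t1 //; apply/forallP=> i; apply: tP.
Qed.

Lemma leq_Ibase (G H : {set gT}) l : stab_chain G H l 1 -> l <= Ibase G H.
Proof.
move=> Gl; have lt_l : l < #|G|.+1.
  by rewrite ltnS; apply: leq_trans (stab_chain_card Gl); rewrite leq_addr.
by apply: (@leq_bigmax_cond _ _ _ (Ordinal lt_l)); apply/irred_baseP.
Qed.

Lemma Ibase_leq (G H : {set gT}) n :
  (forall l, stab_chain G H l 1 -> l <= n) -> Ibase G H <= n.
Proof. by move=> Hn; apply/bigmax_leqP=> l /irred_baseP/Hn. Qed.

Lemma stab_chain_group (G H : {group gT}) l K :
  stab_chain G H l K -> group_set K.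
Proof.
elim=> [|{}l {}K g _ gK _ _]; first exact: groupP.
exact: (groupP (Group gK :&: H :^ g)).
Qed.

End StabChains.

(** * Arithmetic of the number of prime factors *)

Section BigOmega.

(** A summation range independent of [k] lets multiplicativity be checked term by term. *)
Lemma bigOmegaE k n : k < n -> bigOmega k = \sum_(q < n) logn q k.
Proof.
move=> lt_kn; rewrite -(big_mkord xpredT (fun q => logn q k)).
rewrite (bigID (fun q => q \in primes k)) /= addnC big1 => [|q]; last first.
  by rewrite -logn_gt0 lt0n negbK => /eqP.
rewrite add0n -big_filter; apply: perm_big; apply: uniq_perm.
- exact: primes_uniq.
- by rewrite filter_uniq // iota_uniq.
move=> q; rewrite mem_filter; case qk: (q \in primes k) => //=.
move: qk; rewrite mem_primes => /and3P[_ k_gt0 q_dv].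
by rewrite mem_index_iota (leq_ltn_trans (dvdn_leq k_gt0 q_dv)).
Qed.

Lemma bigOmegaM m n : 0 < m -> 0 < n -> bigOmega (m * n) = bigOmega m + bigOmega n.
Proof.
move=> m_gt0 n_gt0; have mn_gt0 : 0 < m * n by rewrite muln_gt0 m_gt0.
rewrite (@bigOmegaE _ (m * n).+1) // (@bigOmegaE m (m * n).+1); last first.
  by rewrite ltnS leq_pmulr.
rewrite (@bigOmegaE n (m * n).+1); last by rewrite ltnS leq_pmull.
by rewrite -big_split; apply: eq_bigr => q _; rewrite lognM.
Qed.

Lemma bigOmega1 : bigOmega 1 = 0.
Proof. by rewrite /bigOmega big_nil. Qed.

Lemma bigOmega_prime q : prime q -> bigOmega q = 1.
Proof. by move=> q_pr; rewrite /bigOmega primes_prime // big_seq1 logn_prime // eqxx. Qed.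

Lemma bigOmegaX q k : prime q -> bigOmega (q ^ k) = k.
Proof.
move=> q_pr; elim: k => [|k IHk]; first exact: bigOmega1.
have q_gt0 := prime_gt0 q_pr.
by rewrite expnS bigOmegaM ?expn_gt0 ?q_gt0 // IHk (bigOmega_prime q_pr).
Qed.

Lemma expn_bigOmega k : 0 < k -> 2 ^ bigOmega k <= k.
Proof.
elim/ltn_ind: k => k IHk k_gt0; have [le_k1|gt_k1] := leqP k 1.
  by rewrite (_ : k = 1) ?bigOmega1 //; apply/eqP; rewrite eqn_leq le_k1.
have q_pr := pdiv_prime gt_k1; have q_dv := pdiv_dvd k.
have lt_k : k %/ pdiv k < k by rewrite ltn_Pdiv ?prime_gt1.
have k'_gt0 : 0 < k %/ pdiv k by rewrite divn_gt0 ?prime_gt0 // dvdn_leq.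
have -> : bigOmega k = (bigOmega (k %/ pdiv k)).+1.
  by rewrite -[in LHS](divnK q_dv) bigOmegaM ?pdiv_gt0 // (bigOmega_prime q_pr) addn1.
rewrite expnSr.
by rewrite -[leqRHS](divnK q_dv) leq_mul ?IHk ?prime_gt1.
Qed.

Lemma bigOmega_gt0 k : 1 < k -> 0 < bigOmega k.
Proof.
move=> k_gt1; have [m def_k] := dvdnP (pdiv_dvd k).
have := ltnW k_gt1; rewrite {1}def_k muln_gt0 => /andP[m_gt0 q_gt0].
by rewrite def_k bigOmegaM // (bigOmega_prime (pdiv_prime k_gt1)) addn1.
Qed.

Lemma bigOmega_dvd_lt m n : 0 < n -> m %| n -> m < n -> bigOmega m < bigOmega n.
Proof.
move=> n_gt0 /dvdnP[k def_n] lt_mn; move: n_gt0 lt_mn.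
rewrite def_n muln_gt0 => /andP[k_gt0 m_gt0].
rewrite -{1}[m]mul1n ltn_pmul2r // => k_gt1.
by rewrite bigOmegaM // -{1}[bigOmega m]add0n ltn_add2r bigOmega_gt0.
Qed.

Lemma bigOmega_dvd m n : 0 < n -> m %| n -> bigOmega m <= bigOmega n.
Proof.
move=> n_gt0 dv_mn; have := dvdn_leq n_gt0 dv_mn.
by rewrite leq_eqVlt => /predU1P[->|/(bigOmega_dvd_lt n_gt0 dv_mn)/ltnW].
Qed.

End BigOmega.

(** * Upper bounds from prime factors of group orders *)

Section ChainBounds.

Local Open Scope group_scope.

Variables (gT : finGroupType) (G H : {group gT}).

Lemma bigOmega_proper (K L : {group gT}) :
  K \proper L -> bigOmega #|K| < bigOmega #|L|.
Proof.
by move=> KL; rewrite bigOmega_dvd_lt ?cardG_gt0 ?cardSg ?proper_card ?proper_sub.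
Qed.

(** The first coset is stabilised by a conjugate of [H]; a second step is strict only if it brings
    in a different conjugate. *)
Lemma stab_chain_cases l K : H \subset G -> stab_chain G H l K ->
  [\/ l = 0 /\ K = G, l = 1%N /\ exists2 g, g \in G & K = H :^ g |
   1%N < l /\ exists g h, [/\ g \in G, h \in G, H :^ g != H :^ h
                         & K \subset H :^ g :&: H :^ h]].
Proof.
move=> sHG; elim=> [|{}l {}K g GK IH gG KP]; first by constructor 1.
case: IH => [[-> def_K]|[-> [h hG def_K]]|[l_gt1 [h [k [hG kG hk sK]]]]].
- constructor 2; split=> //; exists g => //.
  by rewrite def_K; apply/setIidPr; rewrite -(conjGid gG) conjSg.
- constructor 3; split=> //; exists h, g; split; rewrite ?def_K //.
  by apply: contraTneq KP => hg; rewrite def_K hg setIid properxx.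
- constructor 3; split; first exact: ltnW.
  by exists h, k; split; rewrite // subIset ?sK.
Qed.

(** By Lagrange, every step after the [j]-th costs at least one prime factor, and [n] controls the
    order reached at step [j]. *)
Lemma stab_chain_bigOmega n j l K : 0 < n ->
  (forall L : {group gT}, stab_chain G H j L -> #|L| %| n) ->
  stab_chain G H l K -> j <= l ->
  l + bigOmega #|K| <= j + bigOmega n.
Proof.
move=> n_gt0 Hj; elim=> [|{}l {}K g GK IH gG KP].
  rewrite leqn0 => /eqP j0; rewrite j0 leq_add2l bigOmega_dvd // Hj // j0.
  exact: stab_chain0.
have gK := stab_chain_group GK.
have gK' := stab_chain_group (stab_chainS GK gG KP).
rewrite leq_eqVlt => /predU1P[def_j|].
  rewrite def_j leq_add2l bigOmega_dvd //.
  by apply: (Hj (Group gK')); rewrite def_j; apply: stab_chainS.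
rewrite ltnS => /IH; apply: leq_trans; rewrite addSnnS leq_add2l.
exact: (@bigOmega_proper (Group gK') (Group gK)).
Qed.

Lemma Ibase_leq_bigOmega : H \subset G -> Ibase G H <= (bigOmega #|H|).+1.
Proof.
move=> sHG; apply: Ibase_leq => -[//|l] Gl.
rewrite -(addn0 l.+1) -[X in _ + X <= _]bigOmega1 -[in leqLHS](cards1 (1 : gT)) -[leqRHS]add1n.
apply: (@stab_chain_bigOmega _ 1%N _ [1 gT]) => // L /(stab_chain_cases sHG).
by case=> [[//]|[_ [g _ ->]]|[//]]; rewrite cardJg.
Qed.

(** Prime factors are counted from step 2 on, where the group lies in two distinct conjugates of
    [H]; shorter chains satisfy the bound trivially. *)
Lemma Ibase_leq_bigOmega2 n : H \subset G -> 0 < n ->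
  (forall g h, g \in G -> h \in G -> H :^ g != H :^ h ->
     #|H :^ g :&: H :^ h| %| n) ->
  Ibase G H <= 2 + bigOmega n.
Proof.
move=> sHG n_gt0 Hn; apply: Ibase_leq => -[//|[//|l]] Gl.
rewrite -(addn0 l.+2) -[X in _ + X <= _]bigOmega1 -[in leqLHS](cards1 (1 : gT)).
apply: (@stab_chain_bigOmega _ 2 _ [1 gT]) => // L /(stab_chain_cases sHG).
case=> [[//]|[//]|[_ [g [h [gG hG gh sL]]]]].
apply: dvdn_trans (Hn g h gG hG gh).
exact: (@cardSg _ (H :^ g :&: H :^ h)%G L sL).
Qed.

End ChainBounds.

(** * From the symmetric to the alternating group *)

Section AltChains.

Local Open Scope group_scope.

Variables (T : finType) (A : {group {perm T}}).
Hypothesis oddA : exists2 a, a \in A & odd_perm a.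

(** Left translation by an odd element of [K] exchanges its even and odd elements. *)
Lemma card_Alt_setI (K : {group {perm T}}) :
  ~~ (K \subset 'Alt_T) -> #|K| = (2 * #|K :&: 'Alt_T|)%N.
Proof.
case/subsetPn=> a aK aA; rewrite -(cardsID 'Alt_T K) mulSn mul1n; congr addn.
rewrite -[RHS](card_imset _ (mulgI a)); apply: eq_card => s.
apply/idP/imsetP=> [/setDP[sK sA]|[r /setIP[rK rA] ->]].
  exists (a^-1 * s); last by rewrite mulKVg.
  rewrite inE groupM ?groupV //= Alt_even odd_permM odd_permV.
  by move: aA sA; rewrite !Alt_even !negbK => -> ->.
apply/setDP; split; first exact: groupM.
by move: aA rA; rewrite !Alt_even odd_permM; do 2!case: odd_perm.
Qed.

Lemma conjsg_Alt (B : {set {perm T}}) g : 'Alt_T :&: B :^ g = ('Alt_T :&: B) :^ g.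
Proof. by rewrite conjIg (normP (subsetP (normal_norm (Alt_normal T)) g _)) // inE. Qed.

(** A step is lost only when it leaves the even part unchanged. Then [K] has odd elements and its
    successor has none, so this happens at most once; the boolean summand keeps account of it. *)
Lemma stab_chain_Alt l K : stab_chain 'Sym_T A l K ->
  exists2 l', l <= l' + (K \subset 'Alt_T) &
    stab_chain 'Alt_T (A :&: 'Alt_T) l' (K :&: 'Alt_T).
Proof.
have [a aA odd_a] := oddA.
elim=> [|{}l {}K g GK [l' le_l AK] _ KP].
  by exists 0; rewrite // (setIidPr (subsetT _)); apply: stab_chain0.
have gK := stab_chain_group GK.
have gK' := stab_chain_group (stab_chainS GK (in_setT g) KP).
(* Multiplying [g] on the left by the odd element [a] of [A] changes its parity but not the
   conjugate [A :^ g]. *)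
have [h hA Ah] : exists2 h, h \in 'Alt_T & A :^ h = A :^ g.
  have [gA|gA] := boolP (g \in 'Alt_T); first by exists g.
  exists (a * g); last by rewrite conjsgM conjGid.
  by rewrite Alt_even odd_permM odd_a; move: gA; rewrite Alt_even negbK => ->.
have def_K : K :&: A :^ g :&: 'Alt_T = K :&: 'Alt_T :&: (A :&: 'Alt_T) :^ h.
  rewrite [A :&: _]setIC -conjsg_Alt Ah setIA setIAC; congr (_ :&: _).
  by rewrite -setIA setIid.
have step : K :&: A :^ g :&: 'Alt_T \proper K :&: 'Alt_T ->
    stab_chain 'Alt_T (A :&: 'Alt_T) l'.+1 (K :&: A :^ g :&: 'Alt_T).
  by rewrite def_K; apply: stab_chainS.
have sK' : K :&: A :^ g :&: 'Alt_T \subset K :&: 'Alt_T.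
  by rewrite setSI ?subsetIl.
have [eqK|neqK] := eqVneq (K :&: A :^ g :&: 'Alt_T) (K :&: 'Alt_T); last first.
  exists l'.+1; last by apply: step; rewrite properEneq neqK.
  move: le_l; case sK: (K \subset _); last by lia.
  by rewrite subIset ?sK //; lia.
have nsK : ~~ (K \subset 'Alt_T).
  apply: contraTN KP => sK; rewrite properE negb_and negbK; apply/orP; right.
  by apply: subset_trans (subsetIl _ 'Alt_T); rewrite eqK subsetI subxx.
(* Otherwise both groups have twice the order of the same even part, and the step would not be
   strict. *)
have sK'A : K :&: A :^ g \subset 'Alt_T.
  apply: contraTT KP => nsK'; rewrite properEcard negb_and -leqNgt; apply/orP; right.
  have := @card_Alt_setI (Group gK) nsK; have := @card_Alt_setI (Group gK') nsK'.
  by rewrite /= eqK => -> ->.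
by exists l'; rewrite ?eqK // sK'A; move: le_l; rewrite (negPf nsK); lia.
Qed.

Lemma Alt_neq_Sym : ('Alt_T == 'Sym_T :> {set _}) = false.
Proof.
have [a aA odd_a] := oddA.
by apply/eqP=> /setP/(_ a); rewrite in_setT Alt_even odd_a.
Qed.

(** The successor on the right matches [eps_SA G = 1] for the symmetric group, and pays for the step
    that may be lost for the alternating group. *)
Lemma leq_Ibase_SymAlt (G : {group {perm T}}) l :
  G = 'Sym_T :> {set _} \/ G = 'Alt_T :> {set _} ->
  stab_chain 'Sym_T A l 1 -> l + eps_SA G <= (Ibase G (A :&: G)).+1.
Proof.
rewrite /eps_SA; case=> -> Gl.
  by rewrite eqxx addn1 ltnS leq_Ibase // (setIidPl (subsetT _)).
rewrite Alt_neq_Sym addn0; have [l' le_l Al'] := stab_chain_Alt Gl.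
rewrite sub1G addn1 in le_l; apply: leq_trans le_l _; rewrite ltnS leq_Ibase //.
by move: Al'; rewrite (setIidPl (sub1G _)).
Qed.

Lemma card_setI_SymAlt (G : {group {perm T}}) :
  G = 'Sym_T :> {set _} \/ G = 'Alt_T :> {set _} ->
  #|A| = (#|A :&: G| * 2 ^ (1 - eps_SA G))%N /\ eps_SA G <= 1%N.
Proof.
have [a aA odd_a] := oddA.
rewrite /eps_SA; case=> ->; rewrite ?eqxx ?Alt_neq_Sym; split=> //.
  by rewrite muln1 (setIidPl (subsetT _)).
by rewrite mulnC card_Alt_setI //; apply/subsetPn; exists a; rewrite // Alt_even odd_a.
Qed.

End AltChains.

(** * The affine group: order, fixed points, conjugates *)

Section AffineGroup.

Local Open Scope ring_scope.

Variables p d : nat.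
Local Notation V := 'rV['F_p]_d.
Implicit Types (s g : {perm V}) (A : 'M['F_p]_d) (b x : V).

Lemma AGLP s :
  reflect (exists A b, A \in unitmx /\ forall x, s x = x *m A + b) (s \in AGL d p).
Proof.
rewrite inE; apply: (iffP existsP) => [[A /existsP[b /andP[uA /forallP sE]]]|].
  by exists A, b; split=> // x; apply/eqP.
case=> A [b [uA sE]]; exists A; apply/existsP; exists b; rewrite uA /=.
by apply/forallP=> x; apply/eqP.
Qed.

Lemma affine_perm A b : A \in unitmx -> {s : {perm V} | forall x, s x = x *m A + b}.
Proof.
move=> uA; have injA : injective (fun x => x *m A + b).
  by move=> x y /addIr/(can_inj (mulmxK uA)).
by exists (perm injA) => x; rewrite permE.
Qed.

Lemma AGL_group_set : group_set (AGL d p).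
Proof.
apply/group_setP; split.
  by apply/AGLP; exists 1%:M, 0; split=> [|x]; rewrite ?unitmx1 // perm1 mulmx1 addr0.
move=> s t /AGLP[A [b [uA sE]]] /AGLP[B [c [uB tE]]]; apply/AGLP.
exists (A *m B), (b *m B + c); split=> [|x]; first by rewrite unitmx_mul uA.
by rewrite permM sE tE mulmxDl mulmxA addrA.
Qed.
Canonical AGL_group := Group AGL_group_set.

Definition linear_part s : 'M['F_p]_d := \matrix_i (s (delta_mx 0 i) - s 0).

Lemma affine_at0 s A b : (forall x, s x = x *m A + b) -> s 0 = b.
Proof. by move->; rewrite mul0mx add0r. Qed.

Lemma linear_partE s A b : (forall x, s x = x *m A + b) -> linear_part s = A.
Proof.
move=> sE; apply/row_matrixP=> i; rewrite rowK (affine_at0 sE) sE addrK.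
by rewrite -rowE.
Qed.

Lemma card_unitmx : prime p -> (0 < d)%N ->
  #|[set A : 'M['F_p]_d | A \in unitmx]| =
    (p ^ 'C(d, 2) * \prod_(1 <= i < d.+1) (p ^ i - 1))%N.
Proof.
move=> p_pr d_gt0; have := card_GL 'F_p d_gt0; rewrite card_Fp // => <-.
case: d d_gt0 => // n _; rewrite -[RHS](card_imset _ val_inj); apply: eq_card => A.
apply/idP/imsetP=> [|[u _ ->]]; last by rewrite inE; apply: (GL_unitmx u).
by rewrite inE => uA; exists (FinRing.Unit uA); rewrite ?inE.
Qed.

(** An affine map is a pair of an invertible matrix and a vector; the [p ^ d] vectors turn
    ['C(d, 2)] into ['C(d.+1, 2)]. *)
Lemma card_AGL : prime p -> (0 < d)%N ->
  #|AGL d p| = (p ^ 'C(d.+1, 2) * \prod_(1 <= i < d.+1) (p ^ i - 1))%N.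
Proof.
move=> p_pr d_gt0; pose f s := (linear_part s, s 0).
have injf : {in AGL d p &, injective f}.
  move=> s t /AGLP[A [b [_ sE]]] /AGLP[B [c [_ tE]]] [].
  rewrite (linear_partE sE) (linear_partE tE) (affine_at0 sE) (affine_at0 tE).
  by move=> AB bc; apply/permP=> x; rewrite sE tE AB bc.
rewrite -(card_in_imset injf) binS bin1 expnD mulnAC -card_unitmx //.
have -> : (p ^ d = #|[set: V]|)%N by rewrite cardsT card_mx card_Fp // mul1n.
rewrite -cardsX; apply: eq_card => -[A b].
apply/imsetP/setXP=> [[s /AGLP[B [c [uB sE]]] [-> ->]]|[]].
  by rewrite (linear_partE sE) !inE.
rewrite inE => uA _; have [s sE] := affine_perm b uA; exists s.
  by apply/AGLP; exists A, b.
by rewrite /f (linear_partE sE) (affine_at0 sE).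
Qed.

(** The fixed points solve [x *m (A - 1%:M) = - b], so unless [A] is the identity they fill at most
    a hyperplane. *)
Lemma AGL_fix s : prime p -> (0 < d)%N -> s \in AGL d p ->
  (p ^ d.-1 < #|[set x | s x == x]|)%N -> s = 1%g.
Proof.
move=> p_pr d_gt0 /AGLP[A [b [uA sE]]] ltF.
have fixE x : (s x == x) = (x *m (A - 1%:M) == - b).
  by rewrite sE mulmxBr mulmx1 -subr_eq0 -[RHS]subr_eq0 opprK addrAC.
have [A1|nA1] := eqVneq A 1%:M.
  have /card_gt0P[x] : (0 < #|[set x | s x == x]|)%N by apply: leq_ltn_trans ltF.
  rewrite inE fixE A1 subrr mulmx0 eq_sym oppr_eq0 => /eqP b0.
  by apply/permP=> y; rewrite sE A1 b0 mulmx1 addr0 perm1.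
have [i /existsP[j nzM]] : exists i, [exists j, (A - 1%:M) i j != 0].
  apply/existsP; apply: contraNT nA1 => /existsPn M0; rewrite -subr_eq0.
  apply/eqP/matrixP=> i j; rewrite [RHS]mxE; apply/eqP; apply: contraNT (M0 i) => Mij.
  by apply/existsP; exists j.
pose F := [set x | s x == x].
(* The translates of [F] along the [i]-th axis are pairwise disjoint: by [fE], the [j]-th coordinate
   of the image under [A - 1%:M] tells them apart. *)
pose f (xc : V * 'F_p) : V := xc.1 + xc.2 *: delta_mx 0 i.
have fE x c : x \in F -> (f (x, c) *m (A - 1%:M)) 0 j = (- b) 0 j + c * (A - 1%:M) i j.
  rewrite inE fixE => /eqP xF; rewrite /f /= mulmxDl xF -scalemxAl -rowE.
  by rewrite mxE [(_ *: _ : V) 0 j]mxE [(row _ _ : V) 0 j]mxE.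
have injf : {in setX F [set: 'F_p] &, injective f}.
  move=> [x c] [y e] /setXP[xF _] /setXP[yF _] fxy.
  have ce : c = e.
    apply: (mulIf nzM); apply: (addrI ((- b) 0 j)).
    by rewrite -(fE x c xF) -(fE y e yF) fxy.
  by move: fxy; rewrite /f ce /= => /addIr->.
have := max_card (mem (f @: setX F [set: 'F_p])).
rewrite card_in_imset // cardsX cardsT card_mx card_Fp // mul1n.
have -> : (p ^ d = p ^ d.-1 * p)%N by rewrite -expnSr prednK.
by rewrite leq_pmul2r ?prime_gt0 // leqNgt ltF.
Qed.

(* An affine map is determined by what it does off a small set, so the
   commutator of [s] and [g], which moves few points, must be trivial. *)
Lemma AGL_small_support s g : prime p -> (0 < d)%N ->
  (p ^ d.-1 + #|[set x | g x != x]|.*2 < p ^ d)%N ->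
  s \in AGL d p -> s \in (AGL d p :^ g)%g -> forall x, s (g x) = g (s x).
Proof.
move=> p_pr d_gt0 ltS sA; rewrite mem_conjg => sgA.
set S := [set x | g x != x] in ltS.
pose r := (s^-1 * s ^ g^-1)%g.
(* Here [g] fixes both [x] and its preimage under [s], so the two factors of [r] cancel at [x]. *)
have rfix x : x \notin S :|: s @: S -> r x = x.
  rewrite !inE negb_or negbK => /andP[/eqP gx xS].
  have gy : g (s^-1%g x) = s^-1%g x.
    apply/eqP; apply: contraNT xS => gy; apply/imsetP; exists (s^-1%g x).
      by rewrite inE.
    by rewrite permKV.
  have gVx : g^-1%g x = x by rewrite -{1}gx permK.
  have gVy : g^-1%g (s^-1%g x) = s^-1%g x by rewrite -{1}gy permK.
  by rewrite /r permM -{1}gVy permJ permKV gVx.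
have r1 : r = 1%g.
  apply: AGL_fix => //; first by rewrite groupM ?groupV.
  have: (#|~: (S :|: s @: S)| <= #|[set x | r x == x]|)%N.
    by apply: subset_leq_card; apply/subsetP=> x; rewrite !inE => xS; rewrite rfix ?inE.
  apply: leq_trans; have := cardsC (S :|: s @: S).
  rewrite card_mx card_Fp // mul1n => cardC.
  have := leq_card_setU S (s @: S); rewrite (card_imset _ perm_inj) => leU.
  rewrite -(ltn_add2r #|S|.*2); apply: leq_trans ltS _.
  by rewrite -cardC addnC leq_add2l -addnn leU.1.
have sg : (s ^ g^-1 = s)%g by rewrite -[LHS](mulKVg s) -/r r1 mulg1.
by move=> x; have := permJ s g^-1 (g x); rewrite sg permK => ->; rewrite permKV.
Qed.

(** A permutation commuting with [g] is its own conjugate by [g]; this is the converse of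
    [AGL_small_support]. *)
Lemma AGL_commute s g : s \in AGL d p -> (forall x, s (g x) = g (s x)) ->
  s \in (AGL d p :^ g)%g.
Proof.
move=> sA sg; rewrite mem_conjg (_ : (s ^ g^-1)%g = s) //.
by apply/permP=> x; rewrite -{1}(permK g x) permJ sg permK.
Qed.

End AffineGroup.

(** * The diagonal torus and its subgroups cut out by roots of unity *)

Section Torus.

Local Open Scope ring_scope.

Variables p d : nat.
Hypotheses (p_pr : prime p) (p_odd : odd p).
Local Notation V := 'rV['F_p]_d.
Implicit Types (s g : {perm V}) (a x : V) (Q : pred V) (k : 'I_d).

Lemma Fp_expr_pred (x : 'F_p) : x != 0 -> x ^+ p.-1 = 1.
Proof.
move=> nz_x; apply/(mulfI nz_x); rewrite mulr1 -exprS prednK ?prime_gt0 //.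
by rewrite -[RHS]expf_card card_Fp.
Qed.

Lemma Fp_prim_root : {w : 'F_p | p.-1.-primitive_root w}.
Proof.
have p1_gt0 : (0 < p.-1)%N by rewrite -ltnS prednK ?prime_gt0 ?prime_gt1.
have: has p.-1.-primitive_root (enum (predC1 (0 : 'F_p))).
  apply: has_prim_root; rewrite ?enum_uniq //.
    apply/allP=> x; rewrite mem_enum => nz_x.
    by rewrite unity_rootE Fp_expr_pred.
  by rewrite -cardE cardC1 card_Fp.
by move=> /hasP/sig2W[w _ w_prim]; exists w.
Qed.

Lemma Fp_2_neq0 : 2%:R != 0 :> 'F_p.
Proof.
rewrite -(dvdn_pcharf (pchar_Fp p_pr)) dvdn_prime2 //.
by apply: contraTneq p_odd => ->.
Qed.

Lemma Fp_oppr_neq (x : 'F_p) : x != 0 -> - x != x.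
Proof.
move=> nz_x; rewrite -subr_eq0 -opprD oppr_eq0 -mulr2n -mulr_natl.
by rewrite mulf_neq0 ?Fp_2_neq0.
Qed.

Lemma rV_oppr_neq x : x != 0 -> - x != x.
Proof.
apply: contraNneq => /rowP xx; apply/eqP/rowP=> i; rewrite mxE; apply/eqP.
by have /eqP := xx i; rewrite mxE; apply: contraTT => /Fp_oppr_neq.
Qed.

(** The full torus is [diag_set xpredT]; the predicate on the diagonal turns each further
    intersection into a conjunction. *)
Definition diag_set Q : {set {perm V}} :=
  [set s : {perm V} | [exists a : V, [&& [forall i, a 0 i != 0], Q a
                            & [forall x : V, s x == \row_i (x 0 i * a 0 i)]]]].

Definition is_diag s a :=
  (forall i, a 0 i != 0) /\ forall x i, s x 0 i = x 0 i * a 0 i.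

Lemma diag_setP Q s : reflect (exists2 a, is_diag s a & Q a) (s \in diag_set Q).
Proof.
rewrite inE; apply: (iffP existsP) => -[a].
  case/and3P=> /forallP nz_a Qa /forallP sE; exists a => //; split=> // x i.
  by rewrite (eqP (sE x)) mxE.
move=> [nz_a sE] Qa; exists a; apply/and3P; split=> //; first exact/forallP.
by apply/forallP=> x; apply/eqP/rowP=> i; rewrite mxE.
Qed.

Lemma eq_diag_set Q Q' : (forall a, (forall i, a 0 i != 0) -> Q a = Q' a) ->
  diag_set Q = diag_set Q'.
Proof.
move=> eqQ; apply/setP=> s.
by apply/diag_setP/diag_setP=> -[a da]; [rewrite eqQ|rewrite -eqQ];
   try (by case: da); exists a.
Qed.

Lemma diag_perm a : (forall i, a 0 i != 0) -> {s : {perm V} | is_diag s a}.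
Proof.
move=> nz_a; have inja : injective (fun x : V => \row_i (x 0 i * a 0 i) : V).
  by move=> x y /rowP xy; apply/rowP=> i; have := xy i; rewrite !mxE => /(mulIf (nz_a i)).
by exists (perm inja); split=> // x i; rewrite permE mxE.
Qed.

Lemma is_diag_inj s a b : is_diag s a -> is_diag s b -> a = b.
Proof.
move=> [_ sa] [_ sb]; apply/rowP=> i; have := sa (const_mx 1) i.
by rewrite sb !mxE !mul1r.
Qed.

Lemma diag_AGL s a : is_diag s a -> s \in AGL d p.
Proof.
move=> [nz_a sE]; apply/AGLP; exists (diag_mx a), 0; split.
  by rewrite unitmxE det_diag unitfE; apply/prodf_neq0.
by move=> x; rewrite addr0 mul_mx_diag; apply/rowP=> i; rewrite sE mxE.
Qed.

Lemma is_diagZ s a c x : is_diag s a -> s (c *: x) = c *: s x.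
Proof. by move=> [_ sE]; apply/rowP=> i; rewrite mxE !sE mxE mulrA. Qed.

Lemma is_diag0 s a : is_diag s a -> s 0 = 0.
Proof. by move=> [_ sE]; apply/rowP=> i; rewrite sE !mxE mul0r. Qed.

Lemma is_diag_delta s a k :
  is_diag s a -> s (delta_mx 0 k) = a 0 k *: delta_mx 0 k.
Proof.
move=> [_ sE]; apply/rowP=> i; rewrite sE !mxE eqxx /= mulrC.
by have [->|] := eqVneq i k; rewrite ?mulr0.
Qed.

Lemma delta_mx_neq0 k : delta_mx 0 k != 0 :> V.
Proof.
by apply/eqP=> /rowP/(_ k)/eqP; rewrite !mxE !eqxx oner_eq0.
Qed.

Lemma scale_delta_inj k : injective (fun c => c *: delta_mx 0 k : V).
Proof. by move=> b c /rowP/(_ k); rewrite !mxE !eqxx !mulr1. Qed.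

Lemma tperm_support (T : finType) (x y : T) :
  (#|[set z | tperm x y z != z]| <= 2)%N.
Proof.
apply: leq_trans (_ : #|[set x; y]| <= 2)%N; last by rewrite cards2; case: (x != y).
apply: subset_leq_card; apply/subsetP=> z; rewrite !inE.
by apply: contraNT; rewrite negb_or => /andP[xz yz]; rewrite tpermD // eq_sym.
Qed.

(** The [m]-th roots of unity, placed on the [k]-th axis. *)
Definition mu_line k m : pred V :=
  [pred x : V | [forall i, (i != k) ==> (x 0 i == 0)] && (x 0 k ^+ m == 1)].

Lemma mu_line_diag k m s a x :
  is_diag s a -> a 0 k ^+ m = 1 -> mu_line k m (s x) = mu_line k m x.
Proof.
move=> [nz_a sE] akm; rewrite /mu_line /= sE exprMn akm mulr1; congr (_ && _).
by apply: eq_forallb => i; rewrite sE mulf_eq0 (negPf (nz_a i)) orbF.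
Qed.

Lemma mu_lineZ k m (c : 'F_p) : mu_line k m (c *: delta_mx 0 k) = (c ^+ m == 1).
Proof.
rewrite /mu_line /= !mxE !eqxx mulr1.
case: forallP => // -[] i; apply/implyP=> ik.
by rewrite !mxE eqxx (negPf ik) mulr0.
Qed.

Lemma mu_line_perm k m (c : 'F_p) : c ^+ m = 1 -> c != 0 ->
  {g : {perm V} | forall x, g x = if mu_line k m x then c *: x else x}.
Proof.
move=> cm nz_c; pose f x : V := if mu_line k m x then c *: x else x.
have muc x : mu_line k m (c *: x) = mu_line k m x.
  rewrite /mu_line /= mxE exprMn cm mul1r; congr (_ && _).
  by apply: eq_forallb => i; rewrite mxE mulf_eq0 (negPf nz_c).
have muf x : mu_line k m (f x) = mu_line k m x.
  by rewrite /f; case: ifP => // mx; rewrite muc.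
have injf : injective f.
  move=> x y fxy; have := muf x; rewrite fxy muf => mxy.
  by move: fxy; rewrite /f mxy; case: ifP => // _; apply: scalerI.
by exists (perm injf) => x; rewrite permE.
Qed.

(* For [m >= 3], [g] multiplies by a primitive root [c] on the [m]-th roots of
   unity of the [k]-th axis. If [a 0 k] is not among them, linearity of
   [g s g^-1] along this axis forces [c = c^-1]. *)
Lemma diag_set_step k (m : nat) : (0 < d)%N -> (p ^ d.-1 + 4 < p ^ d)%N -> (m %| p.-1)%N ->
  exists g, forall Q, diag_set Q :&: (AGL d p :^ g)%g =
                      diag_set [pred a | Q a & a 0 k ^+ m == 1].
Proof.
move=> d_gt0 small m_dv.
suff [g gP] : exists g, forall s a, is_diag s a ->
    s \in (AGL d p :^ g)%g <-> a 0 k ^+ m = 1.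
  exists g => Q; apply/setP=> s; apply/setIP/diag_setP.
    by case=> /diag_setP[a da Qa] /(gP _ _ da)/eqP akm; exists a; rewrite //= Qa.
  case=> a da /andP[Qa /eqP akm]; split; last exact/(gP _ _ da).
  by apply/diag_setP; exists a.
have m_gt0 : (0 < m)%N.
  by apply: dvdn_gt0 m_dv; rewrite -ltnS prednK ?prime_gt0 ?prime_gt1.
(* A transposition moves at most two points; twice two is the 4 in the hypothesis. *)
have small2 x y : (p ^ d.-1 + #|[set z | tperm x y z != z]|.*2 < p ^ d)%N.
  by apply: leq_ltn_trans small; rewrite leq_add2l (leq_double _ 2) tperm_support.
pose e : V := delta_mx 0 k; have nz_e : e != 0 := delta_mx_neq0 k.
(* For [m = 1], [s] fixes 0, so it commutes with the transposition of 0 and [e] iff it fixes [e]. *)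
have [m1|m_neq1] := eqVneq m 1%N.
  exists (tperm 0 e) => s a da; have se := is_diag_delta k da; split=> [sA|].
    have := AGL_small_support p_pr d_gt0 (small2 _ _) (diag_AGL da) sA 0.
    rewrite tpermL (is_diag0 da) tpermL se -[RHS]scale1r => /scale_delta_inj->.
    by rewrite expr1n.
  rewrite m1 expr1 => ak1; apply: AGL_commute (diag_AGL da) _ => x.
  rewrite (inj_tperm _ _ _ (@perm_inj _ s)) (is_diag0 da) se ak1.
  by rewrite scale1r.
(* For [m = 2], commuting with the transposition of [e] and [- e] means preserving this pair, that
   is, [a 0 k] is 1 or -1. *)
have [m2|m_neq2] := eqVneq m 2%N.
  exists (tperm e (- e)) => s a da; have se := is_diag_delta k da.
  have sNe : s (- e) = - (a 0 k *: e) by rewrite -scaleN1r (is_diagZ _ _ da) se scaleN1r.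
  split=> [sA|].
    have := AGL_small_support p_pr d_gt0 (small2 _ _) (diag_AGL da) sA e.
    rewrite tpermL sNe se m2; case: tpermP => [||_ _ /eqP].
    - by rewrite -[RHS]scale1r => /scale_delta_inj->; rewrite expr1n.
    - by rewrite -[RHS]scaleN1r => /scale_delta_inj->; rewrite sqrrN expr1n.
    - move/eqP/eqP; rewrite (negPf (rV_oppr_neq _)) // scaler_eq0 negb_or nz_e andbT.
      by case: da.
  rewrite m2 => /eqP; rewrite sqrf_eq1 => ak; apply: AGL_commute (diag_AGL da) _ => x.
  rewrite (inj_tperm _ _ _ (@perm_inj _ s)) sNe se.
  by case/orP: ak => /eqP->; rewrite ?scale1r // scaleN1r opprK tpermC.
have [w w_prim] := Fp_prim_root; have c_prim := dvdn_prim_root w_prim m_dv.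
set c := w ^+ _ in c_prim; have cm := prim_expr_order c_prim.
have nz_c : c != 0 by rewrite (prim_root_eq0 c_prim) -lt0n.
have [g gE] := mu_line_perm k cm nz_c.
exists g => s a da; have se := is_diag_delta k da; split=> [|akm]; last first.
  apply: AGL_commute (diag_AGL da) _ => x; rewrite !gE (mu_line_diag _ da akm).
  by case: ifP => // _; rewrite (is_diagZ _ _ da).
rewrite mem_conjg => /AGLP[A [b [_ tE]]]; apply/eqP; apply: contraT => akm.
have nz_ak : a 0 k != 0 by case: da.
have tg x : g ((s ^ g^-1)%g x) = s (g x).
  by have := permJ s g^-1 (g x); rewrite permK => ->; rewrite permKV.
have g0 : g 0 = 0 by rewrite gE; case: ifP => // _; rewrite scaler0.
have gV x y : g x = y -> g^-1%g y = x by move=> <-; rewrite permK.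
have b0 : b = 0.
  by rewrite -[RHS](gV _ _ g0) -(is_diag0 da) -g0 -tg permK tE mul0mx add0r.
have gZ (u : 'F_p) : g (u *: e) = (if u ^+ m == 1 then c * u else u) *: e.
  by rewrite gE mu_lineZ; case: ifP; rewrite // scalerA.
have ge : g e = c *: e by rewrite -[in LHS](scale1r e) gZ expr1n eqxx mulr1.
have eA : e *m A = (a 0 k * c) *: e.
  have := tE e; rewrite b0 addr0 => <-; apply: (@perm_inj _ g).
  rewrite tg ge (is_diagZ _ _ da) se scalerA gZ exprMn cm mulr1 (negPf akm).
  by rewrite mulrC.
(* As [(a 0 k)^-1] is not an [m]-th root of unity, [g] fixes this vector; [s] then sends it to [e],
   which [g^-1] sends to [c^-1 *: e]. *)
have eA' : ((a 0 k)^-1 *: e) *m A = c^-1 *: e.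
  have := tE ((a 0 k)^-1 *: e); rewrite b0 addr0 => <-; apply: (@perm_inj _ g).
  rewrite tg !gZ !exprVn cm invr1 eqxx invr_eq1 (negPf akm).
  by rewrite (is_diagZ _ _ da) se !scalerA mulVf // mulfV.
move: eA'; rewrite -scalemxAl eA scalerA mulKf // => /scale_delta_inj cV.
have: c ^+ 2 == 1 by rewrite expr2 {1}cV mulVf.
rewrite -(prim_order_dvd c_prim) => /dvdn_leq-/(_ isT) m_le2.
by move: m_gt0 m_neq1 m_neq2 m_le2; clear; case: m => [|[|[|n]]].
Qed.

End Torus.

(** * Chains down the torus, and an odd affine permutation *)

Section TorusChain.

Local Open Scope ring_scope.

Variables p d : nat.
Hypotheses (p_pr : prime p) (p_odd : odd p) (d_gt0 : (0 < d)%N).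
Local Notation V := 'rV['F_p]_d.
Implicit Types (s g : {perm V}) (a x : V) (Q : pred V) (k : 'I_d).
Local Notation AGL_chain := (stab_chain ('Sym_V)%g (AGL d p)).

Lemma AGL_chainS l K g K' : AGL_chain l K -> K :&: (AGL d p :^ g)%g = K' ->
  (exists2 s, s \in K & s \notin K') -> AGL_chain l.+1 K'.
Proof.
move=> lK <- [s sK sK']; apply: stab_chainS => //.
rewrite properEneq subsetIl andbT; apply: contraNneq sK' => ->.
exact: sK.
Qed.

Definition one_at k (c : 'F_p) : V := \row_i (if i == k then c else 1).

(** The exponent [m] loses its least prime factor at each step. A primitive [m]-th root of unity in
    place [k], with 1 elsewhere, shows strictness; the condition on [Q] admits this witness. *)
Lemma diag_set_chain_coord k Q l m : (p ^ d.-1 + 4 < p ^ d)%N -> (m %| p.-1)%N ->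
  (forall c, Q (one_at k c)) ->
  AGL_chain l (diag_set [pred a | Q a & a 0 k ^+ m == 1]) ->
  AGL_chain (l + bigOmega m)%N (diag_set [pred a | Q a & a 0 k == 1]).
Proof.
move=> small; elim/ltn_ind: m l => m IHm l m_dv Q1 lm.
have m_gt0 : (0 < m)%N.
  by apply: dvdn_gt0 m_dv; rewrite -ltnS prednK ?prime_gt0 ?prime_gt1.
have [m1|m_gt1] := eqVneq m 1%N.
  move: lm; rewrite m1 bigOmega1 addn0.
  by rewrite (@eq_diag_set _ _ _ [pred a | Q a & a 0 k == 1]) // => a _ /=; rewrite expr1.
have [n def_m] := dvdnP (pdiv_dvd m).
have q_pr : prime (pdiv m) by rewrite pdiv_prime // ltn_neqAle eq_sym m_gt1.
have n_gt0 : (0 < n)%N by move: m_gt0; rewrite def_m muln_gt0 => /andP[].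
have lt_nm : (n < m)%N by rewrite [ltnRHS]def_m -[ltnLHS]muln1 ltn_pmul2l ?prime_gt1.
have n_dv_m : (n %| m)%N by rewrite def_m dvdn_mulr.
have n_dv := dvdn_trans n_dv_m m_dv.
rewrite def_m bigOmegaM ?pdiv_gt0 // (bigOmega_prime q_pr) addn1 addnS -addSn.
apply: IHm => //; have [g gE] := diag_set_step p_pr p_odd k d_gt0 small n_dv.
set Qm := [pred a | _ & _] in lm.
rewrite (@eq_diag_set _ _ _ [pred a | Qm a & a 0 k ^+ n == 1]) => [|a _ /=]; last first.
  rewrite -andbA; congr (_ && _).
  have [an|] := eqVneq (a 0 k ^+ n) 1; last by rewrite andbF.
  by have [q ->] := dvdnP n_dv_m; rewrite mulnC exprM an expr1n eqxx.
apply: AGL_chainS lm (gE _) _.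
have [w w_prim] := Fp_prim_root p_pr; have c_prim := dvdn_prim_root w_prim m_dv.
set c := w ^+ _ in c_prim.
have nz_c : c != 0 by rewrite (prim_root_eq0 c_prim) -lt0n.
have nz_a i : one_at k c 0 i != 0 by rewrite mxE; case: ifP; rewrite ?oner_neq0.
have [s ds] := diag_perm nz_a; exists s.
  apply/diag_setP; exists (one_at k c); rewrite //= Q1 mxE eqxx.
  by rewrite (prim_expr_order c_prim) eqxx.
apply/diag_setP=> -[a /(is_diag_inj ds)<- /andP[_]].
by rewrite mxE eqxx -(prim_order_dvd c_prim) gtnNdvd.
Qed.

Lemma diag_set_chain l : (p ^ d.-1 + 4 < p ^ d)%N ->
  AGL_chain l (diag_set xpredT) -> AGL_chain (l + d * bigOmega p.-1)%N [1]%g.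
Proof.
move=> small lT.
pose Q (k : nat) : pred V := [pred a : V | [forall i : 'I_d, (i < k)%N ==> (a 0 i == 1)]].
suff: forall k : nat, (k <= d)%N -> AGL_chain (l + k * bigOmega p.-1)%N (diag_set (Q k)).
  move=> /(_ d (leqnn d)); suff <- : diag_set (Q d) = [1]%g by [].
  apply/setP=> s.
  apply/diag_setP/set1P=> [[a [_ sE] /forallP Qa]|->]; last first.
    exists (const_mx 1); last by apply/forallP=> i; rewrite mxE eqxx implybT.
    by split=> [i|x i]; rewrite ?perm1 mxE ?oner_neq0 ?mulr1.
  apply/permP=> x; rewrite perm1; apply/rowP=> i; rewrite sE.
  by have := Qa i; rewrite ltn_ord => /eqP->; rewrite mulr1.
elim=> [_|k IHk lt_kd].
  rewrite mul0n addn0 (@eq_diag_set _ _ _ xpredT) // => a _.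
  by apply/forallP=> i.
have {}IHk := IHk (ltnW lt_kd); rewrite mulSnr addnA.
rewrite (@eq_diag_set _ _ (Q k.+1) [pred a | Q k a & a 0 (Ordinal lt_kd) == 1]).
  apply: (diag_set_chain_coord _ (dvdnn p.-1)) => //.
    move=> c; apply/forallP=> i; apply/implyP=> lt_ik; rewrite mxE.
    by have [ik|_] := eqVneq i; [move: lt_ik; rewrite ik ltnn | rewrite eqxx].
  (* By Fermat, the condition with exponent [p.-1] holds for every nonzero entry, so the descent
     starts from [Q k] itself. *)
  rewrite (@eq_diag_set _ _ _ (Q k)) // => a nz_a /=.
  by rewrite Fp_expr_pred // eqxx andbT.
move=> a _; apply/forallP/andP=> [Qa|[/forallP Qa ak] i].
  split; last by have := Qa (Ordinal lt_kd); rewrite ltnSn.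
  apply/forallP=> i; apply/implyP=> lt_ik.
  by have /implyP := Qa i; apply; apply: ltnW.
apply/implyP; rewrite ltnS leq_eqVlt => /predU1P[ik|lt_ik]; last exact: (implyP (Qa i)).
by rewrite (_ : i = Ordinal lt_kd) //; apply: val_inj.
Qed.

(* A generator of the multiplicative group acting on one coordinate has twice
   as many orbits as there are vectors with that coordinate equal to 0. *)
Lemma AGL_odd : exists2 s, s \in AGL d p & odd_perm s.
Proof.
have [w w_prim] := Fp_prim_root p_pr; pose k := Ordinal d_gt0.
have p1_gt0 : (0 < p.-1)%N by rewrite -ltnS prednK ?prime_gt0 ?prime_gt1.
have nz_w : w != 0 by rewrite (prim_root_eq0 w_prim) -lt0n.
have nz_a i : one_at k w 0 i != 0 by rewrite mxE; case: ifP; rewrite ?oner_neq0.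
have [s ds] := diag_perm nz_a; exists s; first exact: diag_AGL ds.
have [_ sE] := ds.
have sX n x i : (s ^+ n)%g x 0 i = if i == k then x 0 i * w ^+ n else x 0 i.
  elim: n => [|n IHn]; first by rewrite perm1 mulr1 if_same.
  by rewrite expgSr permM sE IHn mxE; case: ifP; rewrite ?mulr1 // exprSr mulrA.
(* Orbit representatives: [R0] consists of fixed points, and every other orbit meets [R1] exactly
   once. *)
pose R0 := [set x : V | x 0 k == 0]; pose R1 := [set x : V | x 0 k == 1].
have porbR : porbits s = porbit s @: (R0 :|: R1).
  apply/eqP; rewrite eqEsubset; apply/andP; split; last first.
    by apply/subsetP=> _ /imsetP[x _ ->]; apply: imset_f.
  apply/subsetP=> _ /imsetP[x _ ->]; have [x0|nz_x] := eqVneq (x 0 k) 0.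
    by apply: imset_f; rewrite !inE x0 eqxx.
  have [j def_x] := prim_rootP w_prim (Fp_expr_pred p_pr nz_x).
  pose y : V := \row_i (if i == k then 1 else x 0 i).
  have -> : porbit s x = porbit s y.
    apply/eqP; rewrite eq_porbit_mem; apply/porbitP; exists j; apply/rowP=> i.
    by rewrite sX mxE; case: eqP => // ->; rewrite mul1r.
  by apply: imset_f; rewrite !inE mxE !eqxx orbT.
have injR : {in R0 :|: R1 &, injective (porbit s)}.
  move=> x y xR yR /eqP; rewrite eq_porbit_mem => /porbitP[n def_x].
  apply/rowP=> i; have := sX n y i; rewrite -def_x; case: eqP => // -> xy.
  move: xR yR; rewrite !inE xy mulf_eq0 expf_eq0 (negPf nz_w) andbF orbF.
  case/orP=> [/eqP->|y1]; first by rewrite mul0r.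
  by case/orP=> /eqP y0; move: y1; rewrite y0 ?mul0r ?mul1r ?(eq_sym 0) ?oner_eq0 // => /eqP.
rewrite /odd_perm porbR card_in_imset // cardsU.
have -> : R0 :&: R1 = set0.
  by apply/setP=> x; rewrite !inE; case: eqP => // ->; rewrite eq_sym oner_eq0.
have -> : R1 = (fun x => x + delta_mx 0 k) @: R0.
  apply/setP=> x; rewrite inE; apply/eqP/imsetP=> [x1|[y]].
    exists (x - delta_mx 0 k); last by rewrite subrK.
    by rewrite inE !mxE x1 !eqxx subrr.
  by rewrite inE => /eqP y0 ->; rewrite !mxE y0 !eqxx add0r.
rewrite card_imset; last exact: addIr.
(* The sign is the parity of [p ^ d] plus the number of orbits; the former is odd and the latter is
   twice the size of [R0]. *)
by rewrite cards0 subn0 addnn odd_double card_mx card_Fp // mul1n oddX p_odd orbT.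
Qed.

End TorusChain.

(** * Matrix groups with prescribed zeros: from [AGL] down to the torus *)

Section PatternChain.

Local Open Scope ring_scope.

Variables p d : nat.
Hypotheses (p_pr : prime p) (p_odd : odd p) (d_gt0 : (0 < d)%N).
Local Notation V := 'rV['F_p]_d.
Implicit Types (s g : {perm V}) (x : V) (A : 'M['F_p]_d) (Z : rel nat) (X : pred nat).
Local Notation AGL_chain := (stab_chain ('Sym_V)%g (AGL d p)).

(** Patterns are relations on [nat] rather than on ['I_d], so that comparing two of them is linear
    arithmetic. *)
Definition pattern_set Z : {set {perm V}} :=
  [set s : {perm V} | [exists A : 'M['F_p]_d,
    [&& A \in unitmx, [forall i : 'I_d, forall j : 'I_d, Z i j ==> (A i j == 0)]
      & [forall x : V, s x == x *m A]]]].

Lemma pattern_setP Z s :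
  reflect (exists A, [/\ A \in unitmx, forall i j : 'I_d, Z i j -> A i j = 0
                       & forall x, s x = x *m A])
          (s \in pattern_set Z).
Proof.
rewrite inE; apply: (iffP existsP) => -[A].
  case/and3P=> uA /forallP AZ /forallP sE; exists A; split=> // [i j|x]; last exact/eqP.
  by move/(implyP (forallP (AZ i) j))/eqP.
case=> uA AZ sE; exists A; apply/and3P; split=> //.
  by apply/forallP=> i; apply/forallP=> j; apply/implyP=> /AZ/eqP.
by apply/forallP=> x; apply/eqP.
Qed.

Lemma eq_pattern_set Z Z' : (forall i j : 'I_d, Z i j = Z' i j) ->
  pattern_set Z = pattern_set Z'.
Proof.
move=> eqZ; apply/setP=> s; apply/pattern_setP/pattern_setP=> -[A [uA AZ sE]];
  exists A; split=> // i j Zij; apply: AZ; first [by rewrite eqZ | by rewrite -eqZ].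
Qed.

Lemma pattern_set_AGL Z : pattern_set Z \subset AGL d p.
Proof.
apply/subsetP=> s /pattern_setP[A [uA _ sE]]; apply/AGLP; exists A, 0.
by split=> // x; rewrite addr0.
Qed.

Lemma pattern_setI Z Z' : pattern_set Z :&: pattern_set Z' =
  pattern_set (fun i j => Z i j || Z' i j).
Proof.
apply/setP=> s; apply/setIP/pattern_setP=> [[]|[A [uA AZ sE]]]; last first.
  by split; apply/pattern_setP; exists A; split=> // i j Zij; apply: AZ; rewrite Zij ?orbT.
case/pattern_setP=> A [uA AZ sA] /pattern_setP[B [_ BZ sB]].
have AB : A = B by apply/row_matrixP=> i; rewrite !rowE -sA sB.
exists A; split=> // i j /orP[|Zij]; first exact: AZ.
by rewrite AB; apply: BZ.
Qed.

(** The span of the basis vectors with index in [X]. *)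
Definition coord_space X : {set V} :=
  [set x : V | [forall i : 'I_d, ~~ X i ==> (x 0 i == 0)]].

Lemma coord_spaceP X x :
  reflect (forall i : 'I_d, ~~ X i -> x 0 i = 0) (x \in coord_space X).
Proof.
rewrite inE; apply: (iffP forallP) => Xx i; first by move/(implyP (Xx i))/eqP.
by apply/implyP=> /Xx/eqP.
Qed.

Lemma coord_spaceN X x : (- x \in coord_space X) = (x \in coord_space X).
Proof.
by rewrite !inE; apply: eq_forallb => i; rewrite mxE oppr_eq0.
Qed.

Lemma card_coord_space X (j : 'I_d) : ~~ X j -> (#|coord_space X| <= p ^ d.-1)%N.
Proof.
move=> Xj; pose f (xc : V * 'F_p) : V := xc.1 + xc.2 *: delta_mx 0 j.
have injf : {in setX (coord_space X) [set: 'F_p] &, injective f}.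
  move=> [x c] [y e] /setXP[/coord_spaceP/(_ _ Xj) xj _].
  move=> /setXP[/coord_spaceP/(_ _ Xj) yj _] fxy.
  have ce : c = e.
    by move/rowP/(_ j): (fxy); rewrite !mxE xj yj !eqxx !mulr1 !add0r.
  by move: fxy; rewrite /f ce /= => /addIr->.
have := max_card (mem (f @: setX (coord_space X) [set: 'F_p])).
rewrite card_in_imset // cardsX cardsT card_mx card_Fp // mul1n.
have -> : (p ^ d = p ^ d.-1 * p)%N by rewrite -expnSr prednK.
by rewrite leq_pmul2r ?prime_gt0.
Qed.

Lemma coord_space_perm X :
  {g : {perm V} | forall x, g x = if x \in coord_space X then - x else x}.
Proof.
pose f x : V := if x \in coord_space X then - x else x.
have memf x : (f x \in coord_space X) = (x \in coord_space X).
  by rewrite /f; case: ifP => // xX; rewrite coord_spaceN.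
have injf : injective f.
  move=> x y fxy; have := memf x; rewrite fxy memf => xy.
  by move: fxy; rewrite /f xy; case: ifP => // _ /oppr_inj.
by exists (perm injf) => x; rewrite permE.
Qed.

(* [g] is [-1] on the coordinate subspace and the identity off it, so its
   centraliser in [AGL] is the stabiliser of that subspace in [GL]. *)
Lemma AGL_coord_space X (i0 j0 : 'I_d) : X i0 -> ~~ X j0 ->
  exists g, AGL d p :&: (AGL d p :^ g)%g = pattern_set (fun i j => X i && ~~ X j).
Proof.
move=> Xi0 Xj0; have [g gE] := coord_space_perm X; exists g.
set W := coord_space X in gE.
(* The vector 0 lies in [W] but is not moved, so fewer than [p ^ d.-1] points move; since [p >= 3],
   this suffices. *)
have small : (p ^ d.-1 + #|[set x | g x != x]|.*2 < p ^ d)%N.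
  have: (#|[set x | g x != x]| < #|W|)%N.
    apply: proper_card; apply/properP; split.
      by apply/subsetP=> x; rewrite inE gE; case: ifP => //; rewrite eqxx.
    exists 0; first by apply/coord_spaceP=> i; rewrite mxE.
    by rewrite inE gE oppr0 if_same eqxx.
  have := card_coord_space Xj0; rewrite -/W.
  have -> : (p ^ d = p * p ^ d.-1)%N by rewrite -expnS prednK.
  have := odd_prime_gt2 p_odd p_pr.
  move: #|W| #|_| (p ^ d.-1)%N => a b c p_gt2 le_a lt_b.
  have := leq_mul p_gt2 (leqnn c); rewrite -addnn; lia.
have nz_e (i : 'I_d) : delta_mx 0 i != 0 :> V := delta_mx_neq0 p i.
have eW (i : 'I_d) : X i -> delta_mx 0 i \in W.
  move=> Xi; apply/coord_spaceP=> j Xj; rewrite mxE eqxx.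
  by case: eqP Xi => // <-; rewrite (negPf Xj).
apply/setP=> s; apply/setIP/idP=> [[sA sgA]|sP].
  have com := AGL_small_support p_pr d_gt0 small sA sgA.
  have {sA sgA}[A [b [uA sE]]] := AGLP _ sA.
  (* If [s] sent a basis vector of [W] outside [W], commuting with [g] would make that vector equal
     to its opposite. *)
  have seW (i : 'I_d) : X i -> s (delta_mx 0 i) \in W.
    move=> Xi; apply: contraT => seW; have := com (delta_mx 0 i).
    rewrite !gE eW // (negPf seW) => /perm_inj/eqP.
    by rewrite (negPf (rV_oppr_neq p_pr p_odd (nz_e i))).
  have b0 : b = 0.
    apply/eqP; apply: contraT => /(rV_oppr_neq p_pr p_odd)/eqP[].
    have := com (delta_mx 0 i0); rewrite !gE eW // seW // !sE mulNmx opprD.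
    by move/addrI.
  apply/pattern_setP; exists A; split=> // [i j /andP[Xi Xj]|x]; last first.
    by rewrite sE b0 addr0.
  have /coord_spaceP/(_ j Xj) := seW i Xi.
  by rewrite sE b0 addr0 -rowE mxE.
have sA := subsetP (pattern_set_AGL _) _ sP; split=> //.
have /pattern_setP[A [uA AX sE]] := sP.
have sW x : x \in W -> s x \in W.
  move=> /coord_spaceP xX; apply/coord_spaceP=> j Xj; rewrite sE mxE big1 // => i _.
  have [Xi|Xi] := boolP (X i); first by rewrite AX ?mulr0 ?Xi.
  by rewrite xX ?mul0r.
have sWE : s @: W = W.
  apply/eqP; rewrite eqEcard card_imset ?leqnn ?andbT; last exact: perm_inj.
  by apply/subsetP=> _ /imsetP[x xW ->]; apply: sW.
apply: AGL_commute => // x; rewrite !gE -[in RHS]sWE (mem_imset _ _ perm_inj).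
by case: ifP => // _; rewrite !sE mulNmx.
Qed.

(** Strictness is witnessed by the transvection with entry 1 at [(i0, j0)]: it respects [Z], which
    has no diagonal positions, but not [Z']. *)
Lemma pattern_set_step Z Z' X (i0 j0 : 'I_d) l : AGL_chain l (pattern_set Z) ->
  X i0 -> ~~ X j0 -> ~~ Z i0 j0 -> (forall i, ~~ Z i i) ->
  (forall i j : 'I_d, Z' i j = Z i j || (X i && ~~ X j)) ->
  AGL_chain l.+1 (pattern_set Z').
Proof.
move=> lZ Xi0 Xj0 Zij Zii eqZ; have [g gE] := AGL_coord_space Xi0 Xj0.
have neq_ij : i0 != j0 by apply: contraTneq Xi0 => ->.
apply: (AGL_chainS (g := g) lZ).
  rewrite (@eq_pattern_set Z' (fun i j => Z i j || (X i && ~~ X j))) //.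
  rewrite -pattern_setI -gE setIA; congr (_ :&: _).
  exact/esym/setIidPl/pattern_set_AGL.
pose A : 'M['F_p]_d := 1%:M + delta_mx i0 j0.
have uA : A \in unitmx.
  have: A *m (1%:M - delta_mx i0 j0) = 1%:M.
    rewrite mulmxBr mulmx1 mulmxDl mul1mx mul_delta_mx_0 1?eq_sym // addr0.
    by rewrite addrK.
  by case/mulmx1_unit.
have [s sE] := affine_perm 0 uA; exists s.
  apply/pattern_setP; exists A; split=> // [i j Zijs|x]; last by rewrite sE addr0.
  rewrite !mxE; have [ij|_] := eqVneq i j; first by rewrite -ij (negPf (Zii i)) in Zijs.
  case: eqP Zijs => [->|_]; last by rewrite addr0.
  by case: eqP => [->|_ _]; rewrite ?(negPf Zij) // addr0.
apply/pattern_setP=> -[B [_ BZ sB]].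
have AB : A = B.
  by apply/row_matrixP=> i; rewrite !rowE -sB sE addr0.
have := BZ i0 j0; rewrite eqZ Xi0 Xj0 orbT -AB => /(_ isT)/eqP.
by rewrite !mxE (negPf neq_ij) !eqxx add0r oner_eq0.
Qed.

(** The first point is the coset of [AGL] itself; a transposition fixes too many points to be
    affine. *)
Lemma AGL_chain1 : (p ^ d.-1 + 4 < p ^ d)%N -> AGL_chain 1%N (AGL d p).
Proof.
move=> small; apply: (@AGL_chainS _ _ 0%N ('Sym_V)%g 1%g); first exact: stab_chain0.
  by rewrite conjsg1 (setIidPr (subsetT _)).
pose z : V := 0; pose e : V := delta_mx 0 (Ordinal d_gt0); exists (tperm z e); first exact: in_setT.
apply/negP=> tA; have := AGL_fix p_pr d_gt0 tA.
have nz_e : e != 0 := delta_mx_neq0 p _.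
have card_fix : (p ^ d.-1 < #|[set x : V | tperm z e x == x]|)%N.
  have := cardsC [set x : V | tperm z e x != x]; rewrite card_mx card_Fp // mul1n.
  rewrite (_ : ~: _ = [set x : V | tperm z e x == x]); last by apply/setP=> x; rewrite !inE negbK.
  have := tperm_support z e; move: #|_| #|_| small => a b.
  lia.
by move=> /(_ card_fix)/permP/(_ z)/eqP; rewrite tpermL perm1 (negPf nz_e).
Qed.

Lemma AGL_chain2 : (p ^ d.-1 + 4 < p ^ d)%N -> (1 < d)%N ->
  AGL_chain 2 (pattern_set (fun i j => (i < j) && (i < 1))%N).
Proof.
move=> small d_gt1.
have [g gE] := @AGL_coord_space (pred1 0%N) (Ordinal d_gt0) (Ordinal d_gt1) isT isT.
have -> : pattern_set (fun i j => (i < j) && (i < 1))%N =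
          pattern_set (fun i j => pred1 0%N i && ~~ pred1 0%N j).
  by apply: eq_pattern_set => i j /=; case: (val i) (val j) => [|?] [|?] //=; rewrite andbF.
apply: AGL_chainS (AGL_chain1 small) gE _.
pose e : V := delta_mx 0 (Ordinal d_gt0).
(* A nonzero translation shows strictness: it is affine but moves 0. *)
have [s sE] := affine_perm e (unitmx1 'F_p d); exists s.
  by apply/AGLP; exists 1%:M, e; split; rewrite ?unitmx1.
apply/pattern_setP=> -[A [_ _ sA]]; have := sA 0; rewrite sE !mul0mx add0r => /eqP.
by rewrite (negPf (delta_mx_neq0 p _)).
Qed.

(** Row [i] of the matrix is the image of the [i]-th basis vector, so these are the stabilisers of
    growing flags of coordinate subspaces; each step adds one subspace. *)
Lemma pattern_chain_upper m : (p ^ d.-1 + 4 < p ^ d)%N -> (m.+1 < d)%N ->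
  AGL_chain m.+2 (pattern_set (fun i j => (i < j) && (i < m.+1))%N).
Proof.
move=> small; elim: m => [|m IHm] lt_md; first exact: AGL_chain2.
have {}IHm := IHm (ltnW lt_md).
apply: (pattern_set_step (X := fun i => (i < m.+2)%N)
   (i0 := Ordinal (ltnW lt_md)) (j0 := Ordinal lt_md) IHm) => //=.
- by rewrite ltnn.
- by rewrite ltnn andbF.
- by move=> i; rewrite ltnn.
- by move=> i j; lia.
Qed.

Definition lower_zeros (m n i j : nat) : bool :=
  ((i < j) || (j < i) && ((i < m) || (i == m) && (j < n)))%N.

(* The entry [(m, n)] is killed by stabilising the span of the [e_i], [n < i <= m]. *)
Lemma pattern_chain_lower m n l : (m < d)%N -> (n <= m)%N ->
  AGL_chain l (pattern_set (lower_zeros m 0)) ->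
  AGL_chain (l + n)%N (pattern_set (lower_zeros m n)).
Proof.
move=> lt_md + lm; elim: n => [|n IHn] le_nm; first by rewrite addn0.
rewrite addnS; have lt_nd := ltn_trans le_nm lt_md.
apply: (pattern_set_step (X := fun i => (n < i <= m)%N)
   (i0 := Ordinal lt_md) (j0 := Ordinal lt_nd) (IHn (ltnW le_nm))) => /=.
- by rewrite le_nm leqnn.
- by rewrite ltnn.
- by rewrite /lower_zeros !ltnn eqxx !andbF orbF -leqNgt ltnW.
- by move=> i; rewrite /lower_zeros ltnn.
(* Every other zero imposed by this span lies above the diagonal or has already been imposed. *)
- by move=> i j; rewrite /lower_zeros; lia.
Qed.

(** Clearing row [i] takes [i] steps, and these sum to the binomial coefficient. *)
Lemma pattern_chain l m : (m <= d)%N ->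
  AGL_chain l (pattern_set (lower_zeros 0 0)) ->
  AGL_chain (l + 'C(m, 2))%N (pattern_set (lower_zeros m 0)).
Proof.
move=> + l0; elim: m => [|m IHm] lt_md; first by rewrite addn0.
have := pattern_chain_lower lt_md (leqnn m) (IHm (ltnW lt_md)).
rewrite -addnA binS bin1 (@eq_pattern_set _ (lower_zeros m.+1 0)) // => i j.
by rewrite /lower_zeros; lia.
Qed.

Lemma pattern_set_diag : pattern_set (fun i j => i != j) = diag_set xpredT.
Proof.
apply/setP=> s; apply/pattern_setP/diag_setP=> [[A [uA AZ sE]]|[a [nz_a sE] _]].
  have sE' x i : s x 0 i = x 0 i * A i i.
    rewrite sE mxE (bigD1 i) //= big1 ?addr0 // => j ji.
    by rewrite AZ ?mulr0.
  have def_A : A = diag_mx (\row_i A i i).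
    apply/matrixP=> i j; rewrite !mxE; have [->|ij] := eqVneq i j; first by rewrite mulr1n.
    by rewrite mulr0n AZ.
  exists (\row_i A i i) => //; split=> [i|x i]; last by rewrite sE' mxE.
  move: uA; rewrite unitmxE unitfE {1}def_A det_diag => /prodf_neq0/(_ i isT).
  by [].
exists (diag_mx a); split=> [|i j ij|x]; last first.
- by rewrite mul_mx_diag; apply/rowP=> i; rewrite sE mxE.
- by rewrite mxE (negPf (ij : i != j)).
by rewrite unitmxE det_diag unitfE; apply/prodf_neq0.
Qed.

Lemma AGL_chain_diag : (p ^ d.-1 + 4 < p ^ d)%N -> (1 < d)%N ->
  AGL_chain 'C(d.+1, 2) (diag_set xpredT).
Proof.
move=> small d_gt1; rewrite -pattern_set_diag binS bin1 addnC.
rewrite (@eq_pattern_set _ (lower_zeros d 0)); last first.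
  by move=> i j; have := ltn_ord i; have := ltn_ord j; rewrite /lower_zeros; lia.
apply: pattern_chain => //.
(* The last row has nothing above the diagonal, so treating [d.-1] rows yields the triangular group
   after [d] steps. *)
have lt_d : (d.-2.+1 < d)%N by lia.
have := pattern_chain_upper small lt_d.
have -> : d.-2.+2 = d by lia.
rewrite (@eq_pattern_set _ (lower_zeros 0 0)) // => i j; rewrite /lower_zeros.
by have := ltn_ord i; have := ltn_ord j; lia.
Qed.

End PatternChain.

(** * The affine line *)

Section DimensionOne.

Local Open Scope ring_scope.

Variable p : nat.
Hypotheses (p_pr : prime p) (p_odd : odd p).
Local Notation V := 'rV['F_p]_1.
Implicit Types (s g : {perm V}) (x : V).

Lemma affine1E s (A : 'M['F_p]_1) (b : V) : (forall x, s x = x *m A + b) ->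
  forall x, s x 0 0 = x 0 0 * A 0 0 + b 0 0.
Proof. by move=> sE x; rewrite sE !mxE big_ord1. Qed.

Lemma unitmx1_neq0 (A : 'M['F_p]_1) : A \in unitmx -> A 0 0 != 0.
Proof. by rewrite unitmxE det_mx11 unitfE. Qed.

(* [g] is the inversion [z |-> z^-1], with [0^-1 = 0]. If [z |-> A z + b] and its
   conjugate are both affine and [b != 0], comparing them at [0] and at
   [A / b], [- A / b] gives [4 = 1]. *)
Lemma AGL1_inversion : (3 < p)%N ->
  exists g, AGL 1 p :&: (AGL 1 p :^ g)%g = diag_set xpredT.
Proof.
move=> p_gt3; have injf : injective (fun x : V => \row_i (x 0 i)^-1 : V).
  by move=> x y /rowP xy; apply/rowP=> i; have := xy i; rewrite !mxE => /invr_inj.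
exists (perm injf); set g := perm injf; have gE x i : g x 0 i = (x 0 i)^-1.
  by rewrite permE mxE.
have tg s x : g ((s ^ g^-1)%g x) = s (g x).
  by have := permJ s g^-1 (g x); rewrite permK => ->; rewrite permKV.
apply/setP=> s; apply/setIP/diag_setP=> [[]|[a da _]]; last first.
  split; first exact: diag_AGL da.
  rewrite mem_conjg; apply: (@diag_AGL _ _ _ (\row_i (a 0 i)^-1)).
  have [nz_a sE] := da; split=> [i|x i]; first by rewrite mxE invr_eq0.
  apply: invr_inj; rewrite -gE tg sE gE mxE invfM invrK //.
move=> /AGLP[A [b [uA sE]]]; rewrite mem_conjg => /AGLP[B [c [_ tE]]].
have tg0 z : (z * B 0 0 + c 0 0)^-1 = z^-1 * A 0 0 + b 0 0.
  have := tg s (const_mx z) => /rowP/(_ 0).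
  by rewrite gE (affine1E tE) (affine1E sE) gE !mxE.
have nzA := unitmx1_neq0 uA; have b0 : b 0 0 = 0.
  apply/eqP; apply: contraT => nzb.
  have c0 : c 0 0 = (b 0 0)^-1.
    by have := tg0 0; rewrite mul0r add0r invr0 mul0r add0r => <-; rewrite invrK.
  have := tg0 (- (A 0 0 / b 0 0)).
  rewrite invrN invfM invrK !mulNr (mulrAC _ (b 0 0)) mulVf // mul1r addNr => /eqP.
  rewrite invr_eq0 addrC subr_eq0 => /eqP BA.
  have := tg0 (A 0 0 / b 0 0); rewrite -BA invfM invrK (mulrAC _ (b 0 0)) mulVf // mul1r c0.
  have dbl (z : 'F_p) : z + z = 2%:R * z by rewrite mulr_natl mulr2n.
  rewrite !dbl invfM invrK => /(mulIf nzb)/eqP.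
  (* Clearing the denominator gives 4 = 1, so [p] divides 3, against [p > 3]. *)
  rewrite -(inj_eq (mulfI (Fp_2_neq0 p_pr p_odd))) mulfV ?Fp_2_neq0 // eq_sym.
  rewrite -natrM -subr_eq0 -[X in _ - X]/(1%:R) -natrB // -(dvdn_pcharf (pchar_Fp p_pr)).
  by move/dvdn_leq => /(_ isT); rewrite leqNgt p_gt3.
exists A => //; split=> [i|x i]; rewrite (ord1 i) //.
by rewrite (affine1E sE) b0 addr0.
Qed.

Lemma AGL1_chain_diag : (5 < p)%N ->
  stab_chain ('Sym_V)%g (AGL 1 p) 2 (diag_set xpredT).
Proof.
move=> p_gt5; have [g gE] := AGL1_inversion (ltn_trans (isT : 3 < 5)%N p_gt5).
have small : (p ^ 1.-1 + 4 < p ^ 1)%N by rewrite expn1 expn0.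
apply: AGL_chainS (AGL_chain1 p_pr p_odd (ltn0Sn 0) small) gE _.
pose e : V := delta_mx 0 0; have [s sE] := affine_perm e (unitmx1 'F_p 1); exists s.
  by apply/AGLP; exists 1%:M, e; split; rewrite ?unitmx1.
apply/diag_setP=> -[a da _]; have := is_diag0 da; rewrite sE mul0mx add0r => /eqP.
by rewrite (negPf (delta_mx_neq0 p _)).
Qed.

(** The multiplier satisfies both [a ^+ p = 1] and [a ^+ p = a], hence is 1. *)
Lemma AGL1_order_p s : s \in AGL 1 p -> #[s]%g = p ->
  exists2 b : V, b != 0 & forall x, s x = x + b.
Proof.
move=> /AGLP[A [b [uA sE]]] o_s.
have sX n x : (s ^+ n)%g x - (s ^+ n)%g 0 = A 0 0 ^+ n *: x.
  elim: n => [|n IHn]; first by rewrite !perm1 subr0 scale1r.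
  rewrite !expgSr !permM !sE opprD addrACA subrr addr0 -mulmxBl IHn exprSr -scalerA -scalemxAl.
  by congr (_ *: _); rewrite [A in LHS]mx11_scalar mul_mx_scalar.
have A1 : A 0 0 = 1.
  have sp : (s ^+ p = 1)%g by have := expg_order s; rewrite o_s.
  have := sX p (const_mx 1); rewrite sp !perm1 subr0.
  have -> : A 0 0 ^+ p = A 0 0 by rewrite -[RHS]expf_card card_Fp.
  by move/rowP/(_ 0); rewrite !mxE mulr1.
have {}sE x : s x = x + b by rewrite sE [A]mx11_scalar A1 mulmx1.
exists b => //; apply: contraTneq (prime_gt1 p_pr) => b0.
rewrite -o_s (_ : s = 1%g) ?order1 //.
by apply/permP=> x; rewrite sE b0 addr0 perm1.
Qed.

(* Two conjugates of [H] sharing an element of order [p] share the normal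
   Sylow [p]-subgroup, whose normaliser is [AGL_1(p)]. *)
Lemma AGL1_conj_order_p g h y : (y ^ g^-1)%g \in AGL 1 p -> (y ^ h^-1)%g \in AGL 1 p ->
  #[y]%g = p -> (g * h^-1)%g \in AGL 1 p.
Proof.
move=> yg yh o_y; set r := (g * h^-1)%g.
have [b nz_b yE] := AGL1_order_p yg (etrans (orderJ _ _) o_y).
have [c nz_c y'E] := AGL1_order_p yh (etrans (orderJ _ _) o_y).
have nz_b0 : b 0 0 != 0.
  by apply: contraNneq nz_b => b0; apply/eqP/rowP=> i; rewrite (ord1 i) b0 mxE.
have nz_c0 : c 0 0 != 0.
  by apply: contraNneq nz_c => c0; apply/eqP/rowP=> i; rewrite (ord1 i) c0 mxE.
(* Conjugation by [r] takes the translation by [b] to the translation by [c]; as [b] generates the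
   line, iterating determines [r]. *)
have rD x : r (x + b) = r x + c.
  by rewrite -yE -y'E -permJ /r conjgM conjgKV.
have rX n : r (n%:R *: b) = r 0 + n%:R *: c.
  elim: n => [|n IHn]; first by rewrite !scale0r addr0.
  by rewrite !mulrSr !scalerDl !scale1r rD IHn addrA.
apply/AGLP; exists (c 0 0 / b 0 0)%:M, (r 0); split.
  by rewrite unitmxE det_scalar1 unitfE mulf_neq0 ?invr_eq0.
move=> x; have {1}-> : x = ((x 0 0 / b 0 0 : 'F_p) : nat)%:R *: b.
  by apply/rowP=> i; rewrite (ord1 i) mxE natr_Zp divfK.
rewrite rX natr_Zp addrC mul_mx_scalar; congr (_ + _).
by apply/rowP=> i; rewrite (ord1 i) !mxE mulrAC [RHS]mulrAC (mulrC (x 0 0)).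
Qed.

End DimensionOne.

(** * Numerical estimates *)

Section Counting.

Lemma prod_pred_expn_lt p d : 1 < p -> 0 < d ->
  \prod_(1 <= i < d.+1) (p ^ i - 1) < p ^ 'C(d.+1, 2).
Proof.
move=> p_gt1 d_gt0; have p_gt0 := ltnW p_gt1.
(* The empty product gives equality, so the induction carries the weak inequality and the last
   factor makes it strict. *)
have lt_step n : \prod_(1 <= i < n.+1) (p ^ i - 1) <= p ^ 'C(n.+1, 2) ->
    \prod_(1 <= i < n.+2) (p ^ i - 1) < p ^ 'C(n.+2, 2).
  move=> le_n; rewrite big_nat_recr //= binS bin1 expnD.
  apply: leq_ltn_trans (leq_mul le_n (leqnn _)) _.
  by rewrite ltn_pmul2l ?expn_gt0 ?p_gt0 // subn1 prednK // expn_gt0 p_gt0.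
case: d d_gt0 => // d _; apply: (lt_step d).
elim: d => [|d IHd]; first by rewrite big_nil.
exact: ltnW (lt_step _ IHd).
Qed.

(** For [d = 1] this reads [5 < p]; for [d >= 2] the difference of the two powers is at least 2
    times 3. *)
Lemma small_support_bound p d : 2 < p -> 0 < d -> 7 <= p ^ d ->
  p ^ d.-1 + 4 < p ^ d.
Proof.
case: d => // -[|d] p_gt2 _ p7 /=; first by rewrite expn0 expn1 in p7 *; lia.
have q_gt0 : 0 < p ^ d by rewrite expn_gt0; lia.
rewrite !expnS; move: (p ^ d) q_gt0 => q q_gt0.
have := leq_mul p_gt2 (leq_mul p_gt2 q_gt0); have := leq_mul p_gt2 (leqnn (p * q)).
lia.
Qed.

End Counting.

(** * Bounds in terms of prime factors *)

Section Bounds.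

Variables (p d : nat) (G : {group {perm 'rV['F_p]_d}}).
Hypotheses (p_pr : prime p) (p_odd : odd p) (d_gt0 : 0 < d) (pd_ge7 : 7 <= p ^ d).
Hypothesis G_SA :
  G = ('Sym_('rV['F_p]_d))%g :> {set _} \/ G = ('Alt_('rV['F_p]_d))%g :> {set _}.

(** The index of [AGL d p :&: G] in [AGL d p] is 1 or 2, namely [2 ^ (1 - eps_SA G)]. *)
Lemma bigOmega_AGL_setI :
  (bigOmega #|AGL d p :&: G|).+1 = bigOmega #|AGL d p| + eps_SA G.
Proof.
have [-> eps_le1] := card_setI_SymAlt (AGL_odd p_pr p_odd d_gt0) G_SA.
rewrite bigOmegaM ?cardG_gt0 ?expn_gt0 // bigOmegaX // -addnA subnK //.
by rewrite addn1.
Qed.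

Lemma Ibase_AGL_upper : Ibase G (AGL d p :&: G) <= bigOmega #|AGL d p| + eps_SA G.
Proof. by rewrite -bigOmega_AGL_setI; apply/Ibase_leq_bigOmega/subsetIr. Qed.

Lemma Ibase_AGL_lower : (1 < d)%N ->
  ((d * d.+1) %/ 2 + d * bigOmega p.-1 - 1 + eps_SA G <= Ibase G (AGL d p :&: G))%N.
Proof.
move=> d_gt1; have small := small_support_bound (odd_prime_gt2 p_odd p_pr) d_gt0 pd_ge7.
have -> : ((d * d.+1) %/ 2 = 'C(d.+1, 2))%N by rewrite bin2 divn2 mulnC.
have chain := diag_set_chain p_pr p_odd d_gt0 small
                (AGL_chain_diag p_pr p_odd d_gt0 small d_gt1).
(* Positivity keeps the subtraction of 1 from being truncated. *)
have t_gt0 : (0 < 'C(d.+1, 2))%N by rewrite bin_gt0; lia.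
rewrite -ltnS; apply: leq_trans (leq_Ibase_SymAlt (AGL_odd p_pr p_odd d_gt0) G_SA chain).
by rewrite -addSn subn1 prednK // addn_gt0 t_gt0.
Qed.

End Bounds.

(** * The exact value in dimension one *)

Section BoundsDimensionOne.

Local Open Scope group_scope.

Variables (p : nat) (G : {group {perm 'rV['F_p]_1}}).
Hypotheses (p_pr : prime p) (p_odd : odd p) (p_gt5 : 5 < p).
Hypothesis G_SA :
  G = 'Sym_('rV['F_p]_1) :> {set _} \/ G = 'Alt_('rV['F_p]_1) :> {set _}.

Let H := AGL 1 p :&: G.

Lemma card_AGL1 : #|AGL 1 p| = (p * p.-1)%N.
Proof. by rewrite card_AGL // big_nat1 !expn1 subn1. Qed.

(** The index of [H] is a power of 2 and [p] is odd, so [H] keeps the factor [p]. *)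
Lemma AGL1_setI_card : exists2 n, #|H| = (p * n)%N & n %| p.-1.
Proof.
have [card_H _] := card_setI_SymAlt (AGL_odd p_pr p_odd (ltn0Sn 0)) G_SA.
rewrite /= card_AGL1 -/H in card_H.
have p_dv : p %| #|H|.
  have: (p %| #|H| * 2 ^ (1 - eps_SA G))%N by rewrite -card_H dvdn_mulr.
  by rewrite Gauss_dvdl // coprimeXr // coprimen2.
have [n def_H] := dvdnP p_dv; exists n; first by rewrite mulnC.
move: card_H; rewrite def_H mulnAC mulnC => /eqP.
rewrite eqn_pmul2r ?prime_gt0 // => /eqP->; exact: dvdn_mulr.
Qed.

(** If [p] divided this order, Cauchy would give a common element of order [p], and the two
    conjugates would coincide. *)
Lemma AGL1_conj_setI n g h : #|H| = (p * n)%N -> n %| p.-1 ->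
  g \in G -> h \in G -> H :^ g != H :^ h -> #|H :^ g :&: H :^ h| %| n.
Proof.
move=> card_H n_dv gG hG neq_gh.
have p1_gt0 : 0 < p.-1 by rewrite -ltnS prednK ?prime_gt0 ?prime_gt1.
have: #|H :^ g :&: H :^ h| %| (p * n)%N.
  by rewrite -card_H -(cardJg H g); apply: (@cardSg _ _ (H :^ g :&: H :^ h)%G (subsetIl _ _)).
rewrite Gauss_dvdr // coprime_sym prime_coprime //; apply: contra neq_gh.
case/(Cauchy (G := (H :^ g :&: H :^ h)%G) p_pr) => y /setIP[].
rewrite !mem_conjg => /setIP[yg _] /setIP[yh _] o_y.
have rA := AGL1_conj_order_p p_pr yg yh o_y.
have rH : g * h^-1 \in H by rewrite inE rA groupM ?groupV.
by rewrite -[g](mulgKV h) conjsgM (conjGid rH).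
Qed.

Lemma Ibase_AGL1 : Ibase G H = (1 + bigOmega p.-1 + eps_SA G)%N.
Proof.
have p1_gt0 : 0 < p.-1 by rewrite -ltnS prednK ?prime_gt0 ?prime_gt1.
apply/eqP; rewrite eqn_leq; apply/andP; split.
  have [n card_H n_dv] := AGL1_setI_card.
  have n_gt0 := dvdn_gt0 p1_gt0 n_dv.
  have := bigOmega_AGL_setI p_pr p_odd (ltn0Sn 0) G_SA.
  rewrite -/H card_AGL1 card_H !bigOmegaM ?(prime_gt0 p_pr) // (bigOmega_prime p_pr).
  (* The target is now [2 + bigOmega n]: one step to reach a conjugate of [H], one that loses [p],
     then the factors of [n]. *)
  move=> <-; rewrite add1n.
  exact: Ibase_leq_bigOmega2 (subsetIr _ _) n_gt0 (fun g h => AGL1_conj_setI card_H n_dv).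
have small : (p ^ 1.-1 + 4 < p ^ 1)%N by rewrite expn0 expn1.
have chain := diag_set_chain p_pr p_odd (ltn0Sn 0) small
                (AGL1_chain_diag p_pr p_odd p_gt5).
rewrite -ltnS.
apply: leq_trans (leq_Ibase_SymAlt (AGL_odd p_pr p_odd (ltn0Sn 0)) G_SA chain).
by rewrite mul1n.
Qed.

End BoundsDimensionOne.

(* Logarithmic upper bound and conclusion *)
From Stdlib Require Import Reals Lra.

Lemma INR_expn a b : INR (expn a b) = (INR a ^ b)%R.
Proof. by elim: b => //= b IHb; rewrite expnS mult_INR IHb. Qed.

(** Take logarithms in [2 ^ bigOmega n <= n < p ^ t]. *)
Lemma bigOmega_log2R p t n : 1 < p -> 0 < n -> n < expn p t ->
  (INR (bigOmega n) < INR t * log2R (INR p))%R.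
Proof.
move=> p_gt1 n_gt0 lt_n.
have two_gt0 : (0 < INR 2)%R by rewrite /=; lra.
have ln2_gt0 : (0 < ln (INR 2))%R by rewrite (_ : INR 2 = 2%R) //; have := ln_lt_2; lra.
have p_gt0 : (0 < INR p)%R by apply: lt_0_INR; lia.
have: (INR (expn 2 (bigOmega n)) < INR (expn p t))%R.
  by apply: lt_INR; have := leq_ltn_trans (expn_bigOmega n_gt0) lt_n; lia.
rewrite !INR_expn => /(ln_increasing _ _ (pow_lt _ _ two_gt0)).
rewrite !ln_pow // => lt_ln; rewrite /log2R; apply: (Rmult_lt_reg_r _ _ _ ln2_gt0).
by apply: Rlt_le_trans lt_ln _; right; field; lra.
Qed.

(** The factor [p ^ t] of the order contributes exactly [t] prime factors, and the cofactor
    [N < p ^ t] fewer than [t] times the logarithm of [p]. *)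
Lemma Ibase_AGL_lt_log p d (G : {group {perm 'rV['F_p]_d}}) :
  prime p -> odd p -> 0 < d ->
  G = ('Sym_('rV['F_p]_d))%g :> {set _} \/ G = ('Alt_('rV['F_p]_d))%g :> {set _} ->
  (INR (Ibase G (AGL d p :&: G)) <
   INR ((d * d.+1) %/ 2) * (1 + log2R (INR p)) + INR (eps_SA G))%R.
Proof.
move=> p_pr p_odd d_gt0 G_SA; have p_gt1 := prime_gt1 p_pr.
have -> : (d * d.+1) %/ 2 = 'C(d.+1, 2) by rewrite bin2 divn2 mulnC.
set t := 'C(_, _); pose N := \prod_(1 <= i < d.+1) (expn p i - 1).
have N_gt0 : 0 < N.
  rewrite /N big_nat_cond prodn_cond_gt0 // => i /andP[/andP[i_gt0 _] _].
  by rewrite subn_gt0 -{1}(exp1n i) ltn_exp2r.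
have := Ibase_AGL_upper p_pr p_odd d_gt0 G_SA.
rewrite card_AGL // bigOmegaM ?expn_gt0 ?(ltnW p_gt1) // bigOmegaX // -/t -/N => le_I.
have := bigOmega_log2R p_gt1 N_gt0 (prod_pred_expn_lt p_gt1 d_gt0).
have : (INR (Ibase G (AGL d p :&: G)) <= INR (t + bigOmega N + eps_SA G))%R.
  by apply: le_INR; lia.
rewrite !plus_INR; lra.
Qed.

Theorem theorem5 (p d : nat) (G : {group {perm 'rV['F_p]_d}}) :
  prime p -> odd p -> 0 < d -> 7 <= expn p d ->
  (G = ('Sym_('rV['F_p]_d))%g :> {set _} \/ G = ('Alt_('rV['F_p]_d))%g :> {set _}) ->
  let H := AGL d p :&: G in
  let I := Ibase G H in
  let e := eps_SA G in
  let t := (d * d.+1) %/ 2 in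
  (d = 1 -> I = 1 + bigOmega p.-1 + e) /\
  (2 <= d -> (p == 3) || (p == 5) ->
     t + d - 1 + e <= I /\
     (INR I < INR t * (1 + log2R (INR p)) + INR e)%R) /\
  (2 <= d -> 7 <= p ->
     t + d * bigOmega p.-1 - 1 + e <= I /\
     (INR I < INR t * (1 + log2R (INR p)) + INR e)%R).
Proof.
move=> p_pr p_odd d_gt0 pd_ge7 G_SA H I e t.
have p_gt2 := odd_prime_gt2 p_odd p_pr.
split=> [d1|].
  (* The type of [G] depends on [d], so [G] is generalised before [d] becomes 1. *)
  rewrite {}/t {}/I {}/e {}/H; move: G d_gt0 pd_ge7 G_SA; rewrite d1 expn1 => G _ p_ge7.
  exact/Ibase_AGL1/ltnW.
have lt_log := Ibase_AGL_lt_log p_pr p_odd d_gt0 G_SA.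
split=> d_gt1 _; split=> //; have := Ibase_AGL_lower p_pr p_odd d_gt0 pd_ge7 G_SA d_gt1.
  (* For [p] equal to 3 or 5 the general bound is weakened by [bigOmega p.-1 >= 1]. *)
  apply: leq_trans; rewrite leq_add2r leq_sub2r // leq_add2l.
  by rewrite leq_pmulr // bigOmega_gt0 // -ltnS prednK // prime_gt0.
by [].
Qed.
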